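(* Let $N,S,A\ge 1$ and $T\ge 1$ be integers, let $k\in\mathbb{R}_+$, and for each $i\in[N]$ let $P^i$, $C^i$, $p^i_0$ be the transition dynamics, state-action costs and initial state distribution of player $i$. Define $F:\mathbb{R}_+^{N\times(T+1)\times S\times A}\to\mathbb{R}$ by $$F(x^1,\ldots,x^N)=\sum_{i,t,s,a}x^i_{tsa}C^i_{tsa}+\sum_{t,s}k\Big(\sum_{i,a}2x^i_{tsa}+\prod_{i\in[N]}\big(1-\sum_{a}x^i_{tsa}\big)+\sum_a\prod_{i\in[N]}(1-x^i_{tsa})\Big),$$ where the sums range over $i\in[N]$, $t\in\{0,\ldots,T\}$, $s\in[S]$, $a\in[A]$. Then a joint state-action distribution $x=(x^1,\ldots,x^N)$ satisfies the first order KKT conditions of the optimization problem $$\min_{x^1,\ldots,x^N}F(x^1,\ldots,x^N)\quad\text{s.t. } x^i\in\mathcal{X}(P^i,p^i_0)\ \ \forall i\in[N]$$ if and only if $x$ is a Nash equilibrium of the MDP congestion game with costs $(\ell^1,\ldots,\ell^N)$ given by $$\ell^i_{tsa}(x)=C^i_{tsa}+k\big(D^i_{ts}(x)+G^i_{tsa}(x)\big),$$ where $$D^i_{ts}(x)=1-\prod_{j\neq i}\big(1-\sum_{a'}x^j_{tsa'}\big),\qquad G^i_{tsa}(x)=1-\prod_{j\neq i}(1-x^j_{tsa}),$$ for all $i\in[N]$, $t\in\{0,\ldots,T\}$, $s\in[S]$, $a\in[A]$.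
   Context: Notation: $[n]=\{1,\ldots,n\}$; $\Delta_S=\{y\in\mathbb{R}_+^S : \sum_s y_s=1\}$; $\mathbb{R}_+$ denotes the non-negative reals. There are $N$ players with common finite state set $[S]$, finite action set $[A]$ (every action is admissible in every state) and time horizon $\{0,\ldots,T\}$. Player $i$ has costs $C^i\in\mathbb{R}^{(T+1)SA}$, an initial distribution $p^i_0\in\Delta_S$, and transition dynamics $P^i\in\mathbb{R}_+^{TSSA}$, where $P^i_{ts'sa}$ (for $t\in\{0,\ldots,T-1\}$) is the probability of moving to state $s'$ at time $t+1$ when action $a$ is taken in state $s$ at time $t$; thus $\sum_{s'}P^i_{ts'sa}=1$. A feasible state-action distribution of player $i$ is an element of $$\mathcal{X}(P^i,p^i_0)=\Big\{z\in\mathbb{R}_+^{(T+1)SA} : \sum_a z_{0sa}=p^i_{0s}\ \forall s\in[S],\ \ \sum_a z_{(t+1)sa}=\sum_{a,s'}P^i_{tss'a}z_{ts'a}\ \forall t\in\{0,\ldots,T-1\},\ s\in[S]\Big\}.$$ A joint state-action distribution is $x=(x^1,\ldots,x^N)$ with $x^i\in\mathcal{X}(P^i,p^i_0)$ for every $i$; $x^i_{tsa}$ is the joint probability that player $i$ is in state $s$ and takes action $a$ at time $t$. Given costs $\ell^i(x)\in\mathbb{R}^{(T+1)SA}$, the Q-value function $Q^i(x)$ of player $i$ is defined by backward recursion: $$Q^i_{Tsa}(x)=\ell^i_{Tsa}(x),\qquad Q^i_{(t-1)sa}(x)=\ell^i_{(t-1)sa}(x)+\sum_{s'}P^i_{(t-1)s'sa}\min_{a'}Q^i_{ts'a'}(x),\quad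 t\in[T].$$ The joint state-action distribution $x$ is a Nash equilibrium of the MDP congestion game with costs $(\ell^1,\ldots,\ell^N)$ if for all $i\in[N]$, $t\in\{0,\ldots,T\}$, $s\in[S]$, $a\in[A]$: $$x^i_{tsa}>0\ \Rightarrow\ a\in\operatorname{argmin}\{Q^i_{tsa'}(x) : a'\in[A]\}.$$ First order KKT conditions: $x$ is feasible and there exist multipliers for the linear equality constraints defining the sets $\mathcal{X}(P^i,p^i_0)$ and non-negative multipliers for the constraints $x^i_{tsa}\ge 0$ such that the gradient of the Lagrangian in $x$ vanishes and complementary slackness holds ($F$ is differentiated by its polynomial formula). *)

(* Defs.v *)
From HB Require Import structures.
From mathcomp Require Import all_boot all_order all_algebra.
From mathcomp Require Import all_classical all_reals all_analysis.

Set Implicit Arguments.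
Unset Strict Implicit.
Unset Printing Implicit Defensive.

Import Order.TTheory GRing.Theory Num.Theory.
Import numFieldNormedType.Exports.

Local Open Scope ring_scope.

(* Times 0, ..., T are the elements of 'I_T.+1.  For t : 'I_T, a time at which
   a transition takes place, [now t] is t and [next t] is t + 1 in 'I_T.+1. *)
Definition now (T : nat) (t : 'I_T) : 'I_T.+1 := widen_ord (leqnSn T) t.
Definition next (T : nat) (t : 'I_T) : 'I_T.+1 := lift ord0 t.

(* The junk value 0 for n = 0 is never used: every statement assumes n > 0. *)
Definition min_fun (R : realType) (n : nat) : ('I_n -> R) -> R :=
  match n with
  | 0 => fun _ => 0
  | m.+1 => fun f => \big[Num.min/f ord0]_(a < m.+1) f a
  end.

Definition argmin (R : realType) (n : nat) (f : 'I_n -> R) : set 'I_n :=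
  [set a | forall a', f a <= f a'].

Section Model.
Variables (R : realType) (N T S A : nat).

Definition tsa := 'I_T.+1 -> 'I_S -> 'I_A -> R.

Definition joint := 'I_N -> tsa.

(* [P t s' s a] is the probability of moving from s to s' when a is taken. *)
Definition dynamics := 'I_T -> 'I_S -> 'I_S -> 'I_A -> R.

Definition is_dynamics (P : dynamics) : Prop :=
  (forall t s' s a, 0 <= P t s' s a) /\
  (forall t s a, \sum_(s' < S) P t s' s a = 1).

Definition simplex (y : 'I_S -> R) : Prop :=
  (forall s, 0 <= y s) /\ \sum_(s < S) y s = 1.

Definition init_residual (p0 : 'I_S -> R) (z : tsa) (s : 'I_S) : R :=
  \sum_(a < A) z ord0 s a - p0 s.

Definition flow_residual (P : dynamics) (z : tsa) (t : 'I_T) (s : 'I_S) : R :=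
  \sum_(a < A) z (next t) s a
  - \sum_(a < A) \sum_(s' < S) P t s s' a * z (now t) s' a.

(* The set X(P, p0). *)
Definition feasible (P : dynamics) (p0 : 'I_S -> R) (z : tsa) : Prop :=
  [/\ forall t s a, 0 <= z t s a,
      forall s, init_residual p0 z s = 0
    & forall t s, flow_residual P z t s = 0].

Definition joint_feasible (P : 'I_N -> dynamics) (p0 : 'I_N -> 'I_S -> R)
    (x : joint) : Prop :=
  forall i, feasible (P i) (p0 i) (x i).

(* Q-values with n steps to go, i.e. at time T - n, for a stage cost l; the
   [None] branch is unreachable for n <= T. *)
Fixpoint Q_to_go (P : dynamics) (l : tsa) (n : nat) (s : 'I_S) (a : 'I_A)
    {struct n} : R :=
  match n with
  | 0 => l ord_max s a
  | m.+1 =>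
    match insub (T - m.+1)%N : option 'I_T with
    | Some t =>
        l (now t) s a + \sum_(s' < S) P t s' s a * min_fun (Q_to_go P l m s')
    | None => 0
    end
  end.

Definition Q_value (P : dynamics) (l : tsa) : tsa :=
  fun t => Q_to_go P l (T - t).

Lemma Q_value_last (P : dynamics) (l : tsa) s a :
  Q_value P l ord_max s a = l ord_max s a.
Proof. by rewrite /Q_value /= subnn. Qed.

Lemma Q_value_step (P : dynamics) (l : tsa) (t : 'I_T) s a :
  Q_value P l (now t) s a =
  l (now t) s a
  + \sum_(s' < S) P t s' s a * min_fun (Q_value P l (next t) s').
Proof.
rewrite /Q_value /= /bump leq0n add1n.
have -> : (T - t = (T - t.+1).+1)%N by rewrite subnSK.
rewrite /= (_ : T - (T - t.+1).+1 = t)%N ?valK //.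
by rewrite subnSK ?subKn // ltnW.
Qed.

Definition is_nash (P : 'I_N -> dynamics) (l : joint -> joint) (x : joint)
    : Prop :=
  forall i t s a, 0 < x i t s a -> argmin (Q_value (P i) (l x i) t s) a.

(* The polynomial formula of F, taken on the whole space so that it can be
   differentiated at boundary points of the orthant. *)
Definition F (k : R) (C : joint) (x : joint) : R :=
  \sum_(i < N) \sum_(t < T.+1) \sum_(s < S) \sum_(a < A) x i t s a * C i t s a
  + \sum_(t < T.+1) \sum_(s < S)
      k * (\sum_(i < N) \sum_(a < A) 2 * x i t s a
           + \prod_(i < N) (1 - \sum_(a < A) x i t s a)
           + \sum_(a < A) \prod_(i < N) (1 - x i t s a)).

Definition D (x : joint) (i : 'I_N) (t : 'I_T.+1) (s : 'I_S) : R :=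
  1 - \prod_(j < N | j != i) (1 - \sum_(a < A) x j t s a).

Definition G (x : joint) (i : 'I_N) (t : 'I_T.+1) (s : 'I_S) (a : 'I_A) : R :=
  1 - \prod_(j < N | j != i) (1 - x j t s a).

Definition cost (k : R) (C : joint) (x : joint) : joint :=
  fun i t s a => C i t s a + k * (D x i t s + G x i t s a).

Definition update (x : joint) (i : 'I_N) (t : 'I_T.+1) (s : 'I_S) (a : 'I_A)
    (y : R) : joint :=
  fun j u r b =>
    if [&& j == i, u == t, r == s & b == a] then y else x j u r b.

Definition is_partial (f : joint -> R) (x : joint) (i : 'I_N) (t : 'I_T.+1)
    (s : 'I_S) (a : 'I_A) (d : R) : Prop :=
  is_derive (x i t s a) (1 : R) (fun y : R => f (update x i t s a y)) d.

Definition lagrangian (f : joint -> R) (P : 'I_N -> dynamics)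
    (p0 : 'I_N -> 'I_S -> R) (lambda : 'I_N -> 'I_S -> R)
    (nu : 'I_N -> 'I_T -> 'I_S -> R) (mu : joint) (x : joint) : R :=
  f x
  + \sum_(i < N) \sum_(s < S) lambda i s * init_residual (p0 i) (x i) s
  + \sum_(i < N) \sum_(t < T) \sum_(s < S)
      nu i t s * flow_residual (P i) (x i) t s
  - \sum_(i < N) \sum_(t < T.+1) \sum_(s < S) \sum_(a < A)
      mu i t s a * x i t s a.

(* First order KKT conditions for minimizing f over the x such that x^i is in
   X(P^i, p0^i) for all i. *)
Definition is_KKT (f : joint -> R) (P : 'I_N -> dynamics)
    (p0 : 'I_N -> 'I_S -> R) (x : joint) : Prop :=
  joint_feasible P p0 x /\
  exists (lambda : 'I_N -> 'I_S -> R) (nu : 'I_N -> 'I_T -> 'I_S -> R)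
         (mu : joint),
    [/\ forall i t s a, 0 <= mu i t s a,
        forall i t s a, is_partial (lagrangian f P p0 lambda nu mu) x i t s a 0
      & forall i t s a, mu i t s a * x i t s a = 0].

End Model.

(* Main.v *)
(* F is affine in each coordinate, and its partial derivative in x^i_tsa is the
   cost l^i_tsa.  Let V_ts be minus the multiplier of the equality constraint
   of state s at time t.  Stationarity says that the multiplier of x_tsa >= 0
   is l_tsa + sum_s' P_ts'sa V_(t+1)s' - V_ts, so the KKT conditions say that V
   is a subsolution of the Bellman equation which is tight at every (t, s, a)
   with x_tsa > 0.  If x is Nash, V_ts = min_a Q_tsa is such a subsolution.
   Conversely, V <= Q for every subsolution by backward induction.  V may be
   strictly below min_a Q at states of mass zero, but a state that can be
   reached from a used pair (s, a) has positive mass, so, again by backward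
   induction, V_ts = Q_tsa whenever x_tsa > 0, and a is then optimal. *)
Require Import Defs.
From HB Require Import structures.
From mathcomp Require Import all_boot all_order all_algebra.
From mathcomp Require Import all_classical all_reals all_analysis.
From mathcomp Require Import ring.

Set Implicit Arguments.
Unset Strict Implicit.
Unset Printing Implicit Defensive.

Import Order.TTheory GRing.Theory Num.Theory.
Import numFieldNormedType.Exports.

Local Open Scope ring_scope.

(** * Backward induction on time and minima over actions *)

Lemma time_backward_ind (T : nat) (B : 'I_T.+1 -> Prop) :
  B ord_max -> (forall u : 'I_T, B (Defs.next u) -> B (now u)) -> forall t, B t.
Proof.
move=> Blast Bstep t.
(* The induction runs on a strict bound for the remaining time [T - t]. *)
have [n] := ubnP (T - t)%N; elim: n t => // n IHn t lt_n.
have [tT|] := ltnP t T; last first.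
  move=> leTt; suff -> : t = ord_max by [].
  by apply/val_inj/eqP; rewrite eqn_leq leTt -ltnS ltn_ord.
have -> : t = now (Ordinal tT) by exact: val_inj.
apply/Bstep/IHn; rewrite /= /bump leq0n add1n.
by rewrite -subnSK // ltnS in lt_n.
Qed.

Section MinFun.
Variables (R : realType) (n : nat).

Lemma min_fun_le (f : 'I_n -> R) (a : 'I_n) : min_fun f <= f a.
Proof. by case: n f a => [|m] f a; [case: a | apply: bigmin_le_cond]. Qed.

Lemma le_min_fun (f : 'I_n -> R) (c : R) :
  (0 < n)%N -> (forall a, c <= f a) -> c <= min_fun f.
Proof. by case: n f => [|m] f // _ cf; apply/le_bigmin. Qed.

Lemma argmin_min_fun (f : 'I_n -> R) (a : 'I_n) :
  argmin f a -> f a = min_fun f.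
Proof.
move=> fa; apply/eqP; rewrite eq_le min_fun_le andbT le_min_fun //.
exact: leq_ltn_trans (ltn_ord a).
Qed.

End MinFun.

(** * Subsolutions of the Bellman equation *)

Section Bellman.
Variables (R : realType) (T S A : nat).
Variables (P : dynamics R T S A) (l : tsa R T S A).

(* The inner sum has one term if t < T and none if t = T. *)
Definition bellman (V : 'I_T.+1 -> 'I_S -> R) : tsa R T S A := fun t s a =>
  l t s a + \sum_(u < T | now u == t) \sum_(s' < S) P u s' s a * V (Defs.next u) s'.

Lemma bellman_last V s a : bellman V ord_max s a = l ord_max s a.
Proof.
rewrite /bellman big_pred0 ?addr0 // => u.
by apply/negbTE; rewrite -val_eqE /= ltn_eqF.
Qed.

Lemma bellman_now V u s a :
  bellman V (now u) s a
  = l (now u) s a + \sum_(s' < S) P u s' s a * V (Defs.next u) s'.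
Proof. by rewrite /bellman (big_pred1 u). Qed.

Lemma Q_value_bellman :
  Q_value P l = bellman (fun t s => min_fun (Q_value P l t s)).
Proof.
apply/funext => t; apply/funext => s; apply/funext => a.
elim/time_backward_ind: t => [|u _].
  by rewrite bellman_last Q_value_last.
by rewrite bellman_now Q_value_step.
Qed.

Variable p0 : 'I_S -> R.
Variable z : tsa R T S A.
Hypotheses (hP : is_dynamics P) (hz : feasible P p0 z).

(** Flow conservation makes the mass of [s'] a sum of non-negative inflows, and the one from
    [(s, a)] is positive. *)
Lemma feasible_reached (u : 'I_T) s' s a :
  0 < P u s' s a -> 0 < z (now u) s a -> exists b, 0 < z (Defs.next u) s' b.
Proof.
case: hz => z_ge0 _ /(_ u s')/subr0_eq flow P_gt0 z_gt0.
have P_ge0 := hP.1.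
suff /eqP/psumr_neq0P : \sum_b z (Defs.next u) s' b != 0.
  by case=> // b; exists b.
rewrite flow gt_eqF // (bigD1 a) //= (bigD1 s) //=.
rewrite ltr_pwDl ?ltr_pwDl ?mulr_gt0 //.
  by apply: sumr_ge0 => r _; rewrite mulr_ge0.
by apply: sumr_ge0 => b _; apply: sumr_ge0 => r _; rewrite mulr_ge0.
Qed.

Variable V : 'I_T.+1 -> 'I_S -> R.
Hypothesis V_le : forall t s a, V t s <= bellman V t s a.

(** [bellman] is monotone because [P] is non-negative, and a bound by every action value is a bound
    by their minimum. *)
Lemma subsolution_le_Q t s a : V t s <= Q_value P l t s a.
Proof.
elim/time_backward_ind: t s a => [|u IHu] s a.
  by rewrite Q_value_last -(bellman_last V).
apply: le_trans (V_le _ _ a) _; rewrite bellman_now Q_value_step lerD2l.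
apply: ler_sum => s' _; apply: ler_wpM2l; first exact: hP.1.
by apply: le_min_fun => //; apply: leq_ltn_trans (ltn_ord a).
Qed.

Hypothesis V_eq : forall t s a, 0 < z t s a -> V t s = bellman V t s a.

Lemma subsolution_eq_Q t s a : 0 < z t s a -> V t s = Q_value P l t s a.
Proof.
elim/time_backward_ind: t s a => [|u IHu] s a za; rewrite (V_eq za).
  by rewrite Q_value_last bellman_last.
rewrite bellman_now Q_value_step; congr (_ + _); apply: eq_bigr => s' _.
(* Successors of probability zero drop out; at these [V] may differ from the minimum of the
   Q-values. *)
have := hP.1 u s' s a; rewrite le_eqVlt => /predU1P[<-|P_gt0].
  by rewrite !mul0r.
have [b zb] := feasible_reached P_gt0 za.
(* The used action [b] has value [V], a lower bound for all Q-values at [s'], so it attains their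
   minimum. *)
congr (_ * _); rewrite (IHu _ _ zb); apply: argmin_min_fun => a'.
by rewrite -(IHu _ _ zb) subsolution_le_Q.
Qed.

End Bellman.

(** * Partial derivatives of functions affine in one coordinate *)

Section Slope.
Variables (R : realType) (N T S A : nat) (x : joint R N T S A).
Variables (i : 'I_N) (t : 'I_T.+1) (s : 'I_S) (a : 'I_A).

(** An exact affine identity instead of a derivative: the calculus rules become ring identities, and
    analysis enters only in [is_partial_slope]. *)
Definition has_slope (f : joint R N T S A -> R) (d : R) : Prop :=
  forall y, f (update x i t s a y) = f x + (y - x i t s a) * d.

Lemma is_partial_slope f d e :
  has_slope f d -> is_partial f x i t s a e <-> d = e.
Proof.
move=> fd; rewrite /is_partial (funext fd).
have dd : is_derive (x i t s a) (1 : R)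
    (fun y : R => f x + (y - x i t s a) * d) d.
  by apply: is_derive_eq; rewrite /GRing.scale /=; ring.
split=> [de|<- //].
by rewrite -(@derive_val _ _ _ _ _ _ _ dd) (@derive_val _ _ _ _ _ _ _ de).
Qed.

Lemma has_slope_indep f :
  (forall y, f (update x i t s a y) = f x) -> has_slope f 0.
Proof. by move=> fy y; rewrite fy mulr0 addr0. Qed.

Lemma has_slopeD f g d e :
  has_slope f d -> has_slope g e -> has_slope (fun z => f z + g z) (d + e).
Proof. by move=> fd ge y; rewrite fd ge; ring. Qed.

Lemma has_slopeZ c f d :
  has_slope f d -> has_slope (fun z => c * f z) (c * d).
Proof. by move=> fd y; rewrite fd; ring. Qed.

Lemma has_slopeB f g d e :
  has_slope f d -> has_slope g e -> has_slope (fun z => f z - g z) (d - e).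
Proof. by move=> fd ge y; rewrite fd ge; ring. Qed.

Lemma has_slope_sum (I : finType) (f : I -> joint R N T S A -> R) d :
  (forall j, has_slope (f j) (d j)) ->
  has_slope (fun z => \sum_j f j z) (\sum_j d j).
Proof.
move=> fd y; rewrite mulr_sumr -big_split /=.
by apply: eq_bigr => j _; exact: fd.
Qed.

Lemma has_slope_coord : has_slope (fun z => z i t s a) 1.
Proof. by move=> y; rewrite /update !eqxx /=; ring. Qed.

(** Only one factor moves with the coordinate, so the product stays affine. *)
Lemma has_slope_prod (f : 'I_N -> joint R N T S A -> R) d :
  has_slope (f i) d -> (forall j, j != i -> has_slope (f j) 0) ->
  has_slope (fun z => \prod_j f j z) (d * \prod_(j | j != i) f j x).
Proof.
move=> fi fj y; rewrite (bigD1 i) //= fi [in RHS](bigD1 i) //=.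
rewrite (eq_bigr (fun j => f j x)) => [|j ji]; first by ring.
by rewrite (fj j ji) mulr0 addr0.
Qed.


Lemma has_slope_sum1 (I : finType) (j0 : I) (f : I -> joint R N T S A -> R) d :
  has_slope (f j0) d -> (forall j, j != j0 -> has_slope (f j) 0) ->
  has_slope (fun z => \sum_j f j z) d.
Proof.
move=> f0 fj y; rewrite (bigD1 j0) //= f0 [in RHS](bigD1 j0) //=.
rewrite (eq_bigr (fun j => f j x)) => [|j ji]; first by ring.
by rewrite (fj j ji) mulr0 addr0.
Qed.

Lemma update_player y j : j != i -> update x i t s a y j = x j.
Proof.
by move=> ji; do 3!apply/funext => ?; rewrite /update (negbTE ji).
Qed.

Lemma update_time y j u : u != t -> update x i t s a y j u = x j u.
Proof.
by move=> ut; do 2!apply/funext => ?; rewrite /update (negbTE ut) !andbF.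
Qed.

Lemma update_state y j u r : r != s -> update x i t s a y j u r = x j u r.
Proof.
by move=> rs; apply/funext => ?; rewrite /update (negbTE rs) !andbF.
Qed.

Lemma update_action y j u r b : b != a -> update x i t s a y j u r b = x j u r b.
Proof. by move=> ba; rewrite /update (negbTE ba) !andbF. Qed.

Lemma has_slope_linear (c : joint R N T S A) :
  has_slope (fun z => \sum_j \sum_u \sum_r \sum_b c j u r b * z j u r b)
    (c i t s a).
Proof.
apply: (has_slope_sum1 (j0 := i)); last first.
  by move=> j ji; apply: has_slope_indep => y; rewrite update_player.
apply: (has_slope_sum1 (j0 := t)); last first.
  by move=> u ut; apply: has_slope_indep => y; rewrite update_time.
apply: (has_slope_sum1 (j0 := s)); last first.
  by move=> r rs; apply: has_slope_indep => y; rewrite update_state.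
apply: (has_slope_sum1 (j0 := a)); last first.
  by move=> b ba; apply: has_slope_indep => y; rewrite update_action.
by rewrite -[X in has_slope _ X]mulr1; apply/has_slopeZ/has_slope_coord.
Qed.

Lemma has_slope_mass u r :
  has_slope (fun z => \sum_b z i u r b) ((u == t) && (r == s))%:R.
Proof.
have [->|ut] := eqVneq u t; last first.
  by apply: has_slope_indep => y; rewrite update_time.
have [->|rs] := eqVneq r s; last first.
  by apply: has_slope_indep => y; rewrite update_state.
apply: (has_slope_sum1 (j0 := a)); first exact: has_slope_coord.
by move=> b ba; apply: has_slope_indep => y; rewrite update_action.
Qed.

Lemma has_slope_inflow (p : 'I_S -> 'I_A -> R) u :
  has_slope (fun z => \sum_b \sum_r p r b * z i u r b) ((u == t)%:R * p s a).
Proof.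
have [->|ut] := eqVneq u t; last first.
  by rewrite mul0r; apply: has_slope_indep => y; rewrite update_time.
rewrite mul1r; apply: (has_slope_sum1 (j0 := a)); last first.
  move=> b ba; apply: has_slope_indep => y.
  by apply: eq_bigr => r _; rewrite update_action.
apply: (has_slope_sum1 (j0 := s)); last first.
  by move=> r rs; apply: has_slope_indep => y; rewrite update_state.
by rewrite -[X in has_slope _ X]mulr1; apply/has_slopeZ/has_slope_coord.
Qed.

Lemma has_slope_F k (C : joint R N T S A) :
  has_slope (F k C) (cost k C x i t s a).
Proof.
apply: has_slopeD.
  rewrite (_ : (fun z => _) = fun z =>
      \sum_j \sum_u \sum_r \sum_b C j u r b * z j u r b).
    exact: has_slope_linear.
  apply/funext => z; do 4!apply: eq_bigr => ? _; exact: mulrC.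
apply: (has_slope_sum1 (j0 := t)); last first.
  move=> u ut; apply: has_slope_indep => y.
  apply: eq_bigr => r _; congr (k * (_ + _ + _)).
  - by apply: eq_bigr => j _; rewrite update_time.
  - by apply: eq_bigr => j _; rewrite update_time.
  - by apply: eq_bigr => b _; apply: eq_bigr => j _; rewrite update_time.
apply: (has_slope_sum1 (j0 := s)); last first.
  move=> r rs; apply: has_slope_indep => y; congr (k * (_ + _ + _)).
  - by apply: eq_bigr => j _; rewrite update_state.
  - by apply: eq_bigr => j _; rewrite update_state.
  - by apply: eq_bigr => b _; apply: eq_bigr => j _; rewrite update_state.
(* The 2 is the slope of the linear term of [F] and collects the two 1s in [D] and [G]; each [0 - 1]
   is the slope of a factor of a product. *)
have -> : D x i t s + G x i t s a = 2
    + (0 - 1) * \prod_(j | j != i) (1 - \sum_b x j t s b)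
    + (0 - 1) * \prod_(j | j != i) (1 - x j t s a).
  by rewrite /D /G; ring.
apply: has_slopeZ; apply: has_slopeD; first apply: has_slopeD.
- apply: (has_slope_sum1 (j0 := i)); last first.
    by move=> j ji; apply: has_slope_indep => y; rewrite update_player.
  apply: (has_slope_sum1 (j0 := a)); last first.
    by move=> b ba; apply: has_slope_indep => y; rewrite update_action.
  by rewrite -[X in has_slope _ X]mulr1; apply/has_slopeZ/has_slope_coord.
- apply: (has_slope_prod (f := fun j z => 1 - \sum_b z j t s b)).
    apply: has_slopeB; first exact: has_slope_indep.
    by have := has_slope_mass t s; rewrite !eqxx.
  by move=> j ji; apply: has_slope_indep => y; rewrite update_player.
- apply: (has_slope_sum1 (j0 := a)); last first.
    move=> b ba; apply: has_slope_indep => y.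
    by apply: eq_bigr => j _; rewrite update_action.
  apply: (has_slope_prod (f := fun j z => 1 - z j t s a)).
    by apply: has_slopeB; [exact: has_slope_indep | exact: has_slope_coord].
  by move=> j ji; apply: has_slope_indep => y; rewrite update_player.
Qed.

(** The coordinate enters the constraint of its own state and time with coefficient 1, and those of
    the next time, if there is one, with coefficients [- P]. *)
Lemma has_slope_lagrangian f d (P : 'I_N -> dynamics R T S A) p0 lambda nu mu
    (V : 'I_T.+1 -> 'I_S -> R) :
  has_slope f d ->
  (forall r, V ord0 r = - lambda i r) ->
  (forall u r, V (Defs.next u) r = - nu i u r) ->
  has_slope (lagrangian f P p0 lambda nu mu)
    (d + \sum_(u < T | now u == t) \sum_(r < S) P i u r s a * V (Defs.next u) r
     - V t s - mu i t s a).
Proof.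
move=> fd V0 Vnext.
(* [d0] and [d1] are the slopes of the initial and flow terms as the sum rules produce them. *)
pose d0 := \sum_r lambda i r * ((ord0 == t) && (r == s))%:R.
pose d1 := \sum_u \sum_r nu i u r
  * (((Defs.next u == t) && (r == s))%:R - (now u == t)%:R * P i u r s a).
suff -> : d + \sum_(u < T | now u == t)
      \sum_(r < S) P i u r s a * V (Defs.next u) r - V t s - mu i t s a
    = d + d0 + d1 - mu i t s a.
  apply: has_slopeB (has_slope_linear mu); apply: has_slopeD.
    apply: has_slopeD => //; apply: (has_slope_sum1 (j0 := i)); last first.
      move=> j ji; apply: has_slope_indep => y.
      by rewrite /init_residual update_player.
    apply: has_slope_sum => r; apply: has_slopeZ.
    rewrite -[X in has_slope _ X]subr0.
    by apply: has_slopeB; [exact: has_slope_mass | exact: has_slope_indep].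
  apply: (has_slope_sum1 (j0 := i)); last first.
    move=> j ji; apply: has_slope_indep => y.
    by rewrite /flow_residual update_player.
  do 2!apply: has_slope_sum => ?; apply/has_slopeZ/has_slopeB.
    exact: has_slope_mass.
  exact: has_slope_inflow.
congr (_ - _); rewrite -!addrA; congr (_ + _).
have pick (v : 'I_T.+1) (g : 'I_S -> R) :
    \sum_r g r * ((v == t) && (r == s))%:R = (v == t)%:R * g s.
  rewrite (bigD1 s) //= eqxx andbT big1 ?addr0 ?(mulrC (g s)) // => r /negbTE->.
  by rewrite andbF mulr0.
(* Every time is either 0 or [next u] for a unique [u], so exactly one indicator survives. *)
have -> : V t s = - (d0 + \sum_u (Defs.next u == t)%:R * nu i u s).
  rewrite /d0 pick; transitivity (\sum_v (v == t)%:R * V v s).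
    rewrite (bigD1 t) //= eqxx mul1r big1 ?addr0 // => v /negbTE->.
    exact: mul0r.
  rewrite big_ord_recl V0 opprD mulrN; congr (_ + _).
  by rewrite -sumrN; apply: eq_bigr => u _; rewrite -mulrN -Vnext.
have -> : \sum_(u < T | now u == t) \sum_(r < S) P i u r s a * V (Defs.next u) r
    = - \sum_u \sum_r nu i u r * ((now u == t)%:R * P i u r s a).
  rewrite big_mkcond -sumrN; apply: eq_bigr => u _.
  rewrite -sumrN; case: ifP => _; last first.
    by rewrite big1 // => r _; rewrite mul0r mulr0 oppr0.
  by apply: eq_bigr => r _; rewrite Vnext mul1r mulrN mulrC.
have -> : d1 = \sum_u (Defs.next u == t)%:R * nu i u s
    - \sum_u \sum_r nu i u r * ((now u == t)%:R * P i u r s a).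
  rewrite -sumrB; apply: eq_bigr => u _; rewrite -pick -sumrB.
  by apply: eq_bigr => r _; rewrite mulrBr.
by ring.
Qed.

End Slope.

(** * KKT multipliers as value functions, and the equivalence *)

Lemma KKT_value (R : realType) (N T S A : nat) (k : R) (C : joint R N T S A)
    (P : 'I_N -> dynamics R T S A) (p0 : 'I_N -> 'I_S -> R)
    (x : joint R N T S A) :
  is_KKT (F k C) P p0 x <->
  joint_feasible P p0 x /\ forall i, exists V : 'I_T.+1 -> 'I_S -> R,
    forall t s a,
      V t s <= bellman (P i) (cost k C x i) V t s a
      /\ (0 < x i t s a -> V t s = bellman (P i) (cost k C x i) V t s a).
Proof.
split=> [[xf [lambda [nu [mu [mu_ge0 stat slack]]]]]|[xf /choice[V HV]]].
  split=> // i.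
  (* [unlift ord0] gives [None] at time 0 and [Some u] at [next u], which glues both families of
     multipliers. *)
  pose V t s := if unlift ord0 t is Some u then - nu i u s else - lambda i s.
  have V0 s : V ord0 s = - lambda i s by rewrite /V unlift_none.
  have Vnext u s : V (Defs.next u) s = - nu i u s by rewrite /V liftK.
  exists V => t s a.
  (* Stationarity forces [mu] to be the Bellman gap, so its sign and slackness give the two claims
     on [V]. *)
  have muE : mu i t s a = bellman (P i) (cost k C x i) V t s a - V t s.
    apply/esym/eqP; rewrite -subr_eq0; apply/eqP.
    apply: (is_partial_slope _ _).1 (stat i t s a).
    exact: has_slope_lagrangian (has_slope_F _ _ _ _ _ _ _) V0 Vnext.
  split; first by rewrite -subr_ge0 -muE.
  move=> x_gt0; apply/esym/eqP; rewrite -subr_eq0 -muE.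
  by have /eqP := slack i t s a; rewrite mulf_eq0 (gt_eqF x_gt0) orbF.
split=> //.
exists (fun i s => - V i ord0 s), (fun i u s => - V i (Defs.next u) s).
(* Taking the Bellman gap as [mu] makes the slope of the Lagrangian vanish identically. *)
exists (fun i t s a => bellman (P i) (cost k C x i) (V i) t s a - V i t s).
split=> i t s a.
- by rewrite subr_ge0; case: (HV i t s a).
- apply: (is_partial_slope _ _).2 (subrr _).
  by apply: (has_slope_lagrangian _ _ _ (V := V i) (has_slope_F _ _ _ _ _ _ _))
    => *; rewrite opprK.
- have [x_ge0 _ _] := xf i; have := x_ge0 t s a.
  rewrite le_eqVlt => /predU1P[<-|x_gt0]; first exact: mulr0.
  by rewrite -(HV i t s a).2 // subrr mul0r.
Qed.

Theorem lemma2 (R : realType) (N T S A : nat)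
    (hN : (1 <= N)%N) (hS : (1 <= S)%N) (hA : (1 <= A)%N) (hT : (1 <= T)%N)
    (k : R) (hk : 0 <= k)
    (P : 'I_N -> dynamics R T S A) (hP : forall i, is_dynamics (P i))
    (C : joint R N T S A)
    (p0 : 'I_N -> 'I_S -> R) (hp0 : forall i, simplex (p0 i))
    (x : joint R N T S A) (hx : joint_feasible P p0 x) :
  is_KKT (F k C) P p0 x <-> is_nash P (cost k C) x.
Proof.
rewrite KKT_value; split=> [[_ HV] i t s a x_gt0 a'|nash].
  have [V {}HV] := HV i.
  have V_le u r b := (HV u r b).1; have V_eq u r b := (HV u r b).2.
  (* [V t s] does not depend on the action: it equals the Q-value of [a] and bounds that of [a']
     from below. *)
  rewrite -(subsolution_eq_Q (hP i) (hx i) V_le V_eq x_gt0).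
  exact: (subsolution_le_Q (hP i) V_le).
split=> // i; exists (fun t s => min_fun (Q_value (P i) (cost k C x i) t s)).
(* Applying [bellman] to the minimum of the Q-values returns the Q-values, so tightness at used
   actions is the Nash condition. *)
move=> t s a; rewrite -Q_value_bellman; split; first exact: min_fun_le.
by move=> /nash/argmin_min_fun.
Qed.
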